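(* Let $X$ be a Banach space, let $\{S(t)\}_{t\ge0}\subset L(X)$ be a bounded $C_0$-semigroup, and for $t\ge 0$ let $$T(t):L^1(\mathbb{R},X)\to L^1(\mathbb{R},X),\qquad (T(t)f)(s)=S(t)f(s-t).$$ If $\{T(t)\}_{t\ge0}$ is Eberlein weakly almost periodic, i.e. $\{T(t)f\}_{t\ge0}$ is relatively weakly compact in $L^1(\mathbb{R},X)$ for every $f\in L^1(\mathbb{R},X)$, then $\{T(t)\}_{t\ge0}$ is strongly stable, i.e. $\lim_{t\to\infty}T(t)f=0$ in the norm of $L^1(\mathbb{R},X)$ for every $f\in L^1(\mathbb{R},X)$.
   Context: $L(X)$ is the space of bounded linear operators on $X$; $\{S(t)\}_{t\ge0}$ bounded means $\sup_{t\ge0}\|S(t)\|<\infty$. $L^1(\mathbb{R},X)$ is the space of Bochner integrable functions with respect to Lebesgue measure. *)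

(* Defs.v *)
From HB Require Import structures.
From mathcomp Require Import all_boot all_order all_algebra generic_quotient
  ring_quotient.
From mathcomp Require Import all_classical all_reals all_analysis
  measurable_realfun.

Set Implicit Arguments.
Unset Strict Implicit.
Unset Printing Implicit Defensive.

Import Order.TTheory GRing.Theory Num.Theory.
Import numFieldNormedType.Exports.

Local Open Scope classical_set_scope.
Local Open Scope ring_scope.
Local Open Scope quotient_scope.

Section bounded_operators.
Context {R : realType}.

Record bounded_op (V W : normedModType R) := BoundedOp {
  bounded_op_linear :> {linear V -> W} ;
  bounded_op_continuous : continuous bounded_op_linear }.

Definition opnorm (V W : normedModType R) (f : bounded_op V W) : R :=
  sup [set `|f x| | x in [set x : V | `|x| <= 1]].

Definition dual (V : normedModType R) := bounded_op V R^o.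

Lemma bounded_op_bound (V W : normedModType R) (f : bounded_op V W) :
  exists2 M : R, 0 <= M & forall x, `|f x| <= M * `|x|.
Proof.
have /linear_boundedP/pinfty_ex_gt0[M M0 fM] :=
  (@linear_bounded_continuous _ _ _ f).2 (@bounded_op_continuous _ _ f).
by exists M; [exact: ltW|].
Qed.

Lemma le_opnorm (V W : normedModType R) (f : bounded_op V W) x :
  `|f x| <= opnorm f * `|x|.
Proof.
have [->|x0] := eqVneq x 0; first by rewrite linear0 !normr0 mulr0.
have nx0 : 0 < `|x| by rewrite normr_gt0.
have [M M0 fM] := bounded_op_bound f.
rewrite -ler_pdivrMr//.
have -> : `|f x| / `|x| = `|f (`|x|^-1 *: x)|.
  by rewrite linearZ normrZ normfV normr_id mulrC.
apply: sup_upper_bound; last first.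
  by exists (`|x|^-1 *: x) => //=; rewrite normrZ normfV normr_id mulVf ?gt_eqF.
split; first by exists `|f 0|, 0 => //=; rewrite normr0.
exists M => _ [y /= y1 <-]; apply: le_trans (fM y) _.
by rewrite ler_piMr.
Qed.

(* the topology induced by all x |-> phi x, for phi in the dual space *)
Definition weak_space (V : normedModType R) : topologicalType :=
  initial_topology
    (fun x : V => (fun phi : dual V => phi x) : {ptws dual V -> R^o}).

Definition relatively_weakly_compact (V : normedModType R) (A : set V) :=
  precompact (A : set (weak_space V)).

Lemma cvg_weak_space (V : normedModType R) (F : set_system V) (x : V) :
  Filter F ->
  F --> (x : weak_space V) <-> forall phi : dual V, phi y @[y --> F] --> phi x.
Proof.
move=> FF; pose ev (x : V) : {ptws dual V -> R^o} := fun phi => phi x.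
suff -> : F --> (x : weak_space V) <-> ev @ F --> (ev x : {ptws dual V -> R^o}).
  rewrite cvg_sup; split=> H phi; have := H phi; rewrite cvg_image;
    try by rewrite eqEsubset; split=> v // _; exists (cst v).
  - apply: cvg_trans => W /=; rewrite ?nbhs_simpl /fmap /= => [[W' + <-]].
    by apply: filterS => g W'g /=; exists (ev g).
  - move=> + W /=; rewrite nbhs_simpl => Q => /Q Q'.
    exists ((fun g : dual V -> R => g phi) @^-1` W) => //.
    by rewrite eqEsubset; split=> [j [? + <-//]|j Wj]; exists (fun _ => j).
split=> [Fx A /(@initial_continuous _ _ ev x) Ax|Fx A]; first exact: Fx.
by move=> [_ [[B oB <-] Bx BA]]; apply: filterS BA _; apply/Fx/open_nbhs_nbhs.
Qed.

End bounded_operators.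

Section bochner.
Context d (T : measurableType d) (R : realType).
Variables (mu : {measure set T -> \bar R}).

Definition simple_function (X : Type) (f : T -> X) :=
  finite_set (range f) /\ forall x, measurable (f @^-1` [set x]).

Lemma simple_function_comp2 (X Y Z : Type) (h : X -> Y -> Z) f g :
  simple_function f -> simple_function g ->
  simple_function (fun t => h (f t) (g t)).
Proof.
move=> [ff mf] [fg mg].
pose D := range f `*` range g; have fD : finite_set D by exact: finite_setX.
split.
  apply: (@sub_finite_set _ _ ((fun p => h p.1 p.2) @` D)).
    by move=> _ [t _ <-]; exists (f t, g t) => //; split; exists t.
  exact: finite_image.
move=> z; rewrite [X in measurable X](_ : _ =
    \bigcup_(p in D `&` [set p | h p.1 p.2 = z])
      (f @^-1` [set p.1] `&` g @^-1` [set p.2])).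
  apply: fin_bigcup_measurable => [|p _]; first exact: finite_setIl.
  exact: measurableI.
apply/seteqP; split=> [t /= <-|t [p [_ <-] [/= <- <-]]//].
by exists (f t, g t) => //; split=> //; split; exists t.
Qed.

Lemma simple_function_comp (X Y : Type) (h : X -> Y) f :
  simple_function f -> simple_function (h \o f).
Proof. by move=> sf; exact: (simple_function_comp2 (fun x _ => h x) sf sf). Qed.

Lemma simple_function_cst (X : Type) (x : X) : simple_function (cst x).
Proof.
split; first exact: finite_image_cst.
by move=> y; rewrite preimage_cst; case: ifP.
Qed.

Lemma simple_function_measurable (f : T -> R) :
  simple_function f -> measurable_fun setT f.
Proof.
move=> [ff mf] _ B mB; rewrite setTI [X in measurable X](_ : _ =
    \bigcup_(x in range f `&` B) f @^-1` [set x]).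
  by apply: fin_bigcup_measurable => //; exact: finite_setIl.
apply/seteqP; split=> [t Bft|t [x [_ Bx] /= ->]//].
by exists (f t) => //; split=> //; exists t.
Qed.

Import HBNNSimple.

(* no measurability is assumed: the integral of a nonnegative function is a
   supremum over the simple functions below it *)
Lemma ge0_ae_le_integral_sup (f g : T -> \bar R) :
  (forall t, 0 <= f t)%E -> (forall t, 0 <= g t)%E ->
  {ae mu, forall t, (f t <= g t)%E} ->
  (\int[mu]_t f t <= \int[mu]_t g t)%E.
Proof.
move=> f0 g0 [N [mN N0 fgN]]; rewrite !ge0_integralTE//.
apply: ge_ereal_sup => _ [h /= hf <-].
have [h' hh'] : exists h' : {nnsfun T >-> R},
    forall t, h' t = if t \in N then 0 else h t.
  exists (proj_nnsfun h (measurableC mN)) => t.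
  by rewrite /= mindicE in_setC; case: (t \in N); rewrite ?mulr0 ?mulr1.
rewrite (_ : sintegral mu h = sintegral mu h').
  apply: ereal_sup_ubound; exists h' => //= t; rewrite hh'.
  case: ifPn => [//|tN]; apply: le_trans (hf t) _.
  by apply: contrapT => fg; move/negP: tN; apply; rewrite inE; exact: fgN.
have := @integral_nnsfun _ _ _ mu _ measurableT h'.
have := @integral_nnsfun _ _ _ mu _ measurableT h.
rewrite !patch_setT => <- <-; apply: ge0_ae_eq_integral => //.
- exact/measurable_EFinP.
- exact/measurable_EFinP.
- by move=> t _; rewrite lee_fin.
- by move=> t _; rewrite lee_fin.
exists N; split => // t /= /not_implyP[_ ht]; apply: contrapT => tN.
by apply: ht; rewrite hh' ifF//; apply/negP; rewrite inE.
Qed.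

Lemma ae_preimage (phi : T -> T) (P : T -> Prop) :
  measurable_fun setT phi ->
  (forall N, measurable N -> mu N = 0%E -> mu (phi @^-1` N) = 0%E) ->
  {ae mu, forall t, P t} -> {ae mu, forall t, P (phi t)}.
Proof.
move=> mphi phi0 [N [mN N0 PN]]; exists (phi @^-1` N); split.
- by rewrite -[X in measurable X]setTI; exact: mphi.
- exact: phi0.
- by move=> s /= Ps; exact: PN.
Qed.

Variable X : normedModType R.

(* The limit is only required almost everywhere, so that on R, although
   lebesgue_measure lives on the Borel sets, Lebesgue measurable functions are
   covered; |f| need not be Borel measurable, see ge0_ae_le_integral_sup. *)
Definition strongly_measurable (f : T -> X) :=
  exists2 f_ : nat -> T -> X, (forall n, simple_function (f_ n)) &
    {ae mu, forall t, f_ n t @[n --> \oo] --> f t}.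

Definition int_norm (f : T -> X) : \bar R := (\int[mu]_t `|f t|%:E)%E.

Definition bochner_integrable (f : T -> X) :=
  strongly_measurable f /\ (int_norm f < +oo)%E.

Lemma int_norm_ge0 f : (0 <= int_norm f)%E.
Proof. by apply: integral_ge0 => t _; rewrite lee_fin. Qed.

Lemma le_int_norm f g : {ae mu, forall t, `|f t| <= `|g t|} ->
  (int_norm f <= int_norm g)%E.
Proof.
move=> fg; apply: ge0_ae_le_integral_sup => [t|t|]; rewrite ?lee_fin//.
Qed.

Lemma strongly_measurable_norm f : strongly_measurable f ->
  exists u : T -> R, [/\ measurable_fun setT u, forall t, 0 <= u t,
    {ae mu, forall t, `|f t| = u t} & int_norm f = (\int[mu]_t (u t)%:E)%E].
Proof.
move=> [f_ sf [N [mN N0 fN]]].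
pose u t : R := if t \in N then 0 else `|f t|.
have fu : {ae mu, forall t, `|f t| = u t}.
  exists N; split => // t /=; rewrite /u; case: ifPn => [|_ //].
  by rewrite inE.
have u0 t : 0 <= u t by rewrite /u; case: ifP.
exists u; split=> //.
  have m_ n : measurable_fun setT (fun t => `|f_ n t| * \1_(~` N) t : R).
    apply: measurable_funM; last exact: measurable_indic (measurableC mN).
    exact/simple_function_measurable/(simple_function_comp Num.norm (sf n)).
  apply: (measurable_fun_cvg m_) => t _; rewrite /u indicE in_setC.
  case: ifPn => tN /=; first by under eq_cvg do rewrite mulr0; exact: cvg_cst.
  under eq_cvg do rewrite mulr1; apply: cvg_norm; apply: contrapT => nf.
  by move/negP: tN; apply; rewrite inE; exact: fN.
by apply/eqP; rewrite eq_le; apply/andP; split;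
  apply: ge0_ae_le_integral_sup => [t|t|]; rewrite ?lee_fin//;
  apply: filterS fu => t ->.
Qed.

Lemma int_normD f g : strongly_measurable f -> strongly_measurable g ->
  (int_norm (f + g)%R <= int_norm f + int_norm g)%E.
Proof.
move=> /strongly_measurable_norm[u [mu_ u0 fu ->]].
move=> /strongly_measurable_norm[v [mv v0 gv ->]].
have /measurable_EFinP eu := mu_; have /measurable_EFinP ev := mv.
rewrite -ge0_integralD//; [|by move=> t _; rewrite lee_fin..].
apply: ge0_ae_le_integral_sup => [t|t|]; rewrite ?adde_ge0 ?lee_fin//.
apply: filterS2 fu gv => t ft gt; rewrite lee_fin -ft -gt.
exact: ler_normD.
Qed.

Lemma int_normZ a f : strongly_measurable f ->
  (int_norm (a *: f)%R = `|a|%:E * int_norm f)%E.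
Proof.
move=> /strongly_measurable_norm[u [mu_ u0 fu ->]].
have /measurable_EFinP eu := mu_; rewrite -ge0_integralZl//; [|by move=> t _; rewrite lee_fin..].
by apply/eqP; rewrite eq_le; apply/andP; split;
  apply: ge0_ae_le_integral_sup => [t|t|]; rewrite -?EFinM ?lee_fin ?mulr_ge0//;
  apply: filterS fu => t <-; rewrite -EFinM normrZ.
Qed.

Lemma int_norm_eq0 f : strongly_measurable f -> int_norm f = 0%E ->
  {ae mu, forall t, f t = 0}.
Proof.
move=> /strongly_measurable_norm[u [mu_ u0 fu ->]] iu0.
have : (\int[mu]_t `|(u t)%:E| = 0)%E.
  by rewrite -[RHS]iu0; apply: eq_integral => t _; rewrite gee0_abs ?lee_fin.
move/ae_eq_integral_abs => /(_ measurableT).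
have /measurable_EFinP mu' := mu_.
move=> /(_ mu'); apply: filterS2 fu => t ft /(_ I) [ut].
by apply/eqP; rewrite -normr_eq0 ft ut.
Qed.

Lemma strongly_measurable_cst (x : X) : strongly_measurable (cst x).
Proof.
exists (fun=> cst x); first by move=> n; exact: simple_function_cst.
by apply: aeW => t; exact: cvg_cst.
Qed.

Lemma strongly_measurableD f g : strongly_measurable f ->
  strongly_measurable g -> strongly_measurable (f + g).
Proof.
move=> [f_ sf cf] [g_ sg cg]; exists (fun n => f_ n + g_ n).
  by move=> n; exact: simple_function_comp2.
by apply: filterS2 cf cg => t ft gt; exact: cvgD.
Qed.

Definition bochner : {pred T -> X} := [pred f | `[< bochner_integrable f >]].

Lemma bochnerP f : reflect (bochner_integrable f) (f \in bochner).
Proof. exact: asboolP. Qed.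

Lemma bochner_submod_closed : submod_closed bochner.
Proof.
split.
  apply/bochnerP; split; first exact: strongly_measurable_cst.
  by rewrite /int_norm integral0_eq// => t _; rewrite normr0.
move=> a f g /bochnerP[sf fi] /bochnerP[sg gi].
have saf : strongly_measurable (a *: f).
  have [f_ s_ cf] := sf; exists (fun n => a *: f_ n).
    by move=> n; exact: (simple_function_comp ( *:%R a)).
  by apply: filterS cf => t ft; exact: cvgZr.
apply/bochnerP; split; first exact: strongly_measurableD.
apply: le_lt_trans (int_normD saf sg) _.
rewrite int_normZ// lte_add_pinfty// lte_mul_pinfty//.
Qed.

HB.instance Definition _ :=
  GRing.isSubmodClosed.Build R (T -> X) bochner bochner_submod_closed.

Record bochner_fun := BochnerFun {
  bochner_fun_val :> T -> X ;
  bochner_funP : bochner_fun_val \in bochner }.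

HB.instance Definition _ := [isSub for bochner_fun_val].
HB.instance Definition _ := [Choice of bochner_fun by <:].
HB.instance Definition _ := [SubChoice_isSubLmodule of bochner_fun by <:].

Definition ae_null : {pred bochner_fun} :=
  [pred f : bochner_fun | `[< {ae mu, forall t, f t = 0} >]].

Lemma ae_nullP (f : bochner_fun) :
  reflect {ae mu, forall t, f t = 0} (f \in ae_null).
Proof. exact: asboolP. Qed.

Lemma ae_null_submod_closed : submod_closed ae_null.
Proof.
split; first by apply/ae_nullP; exact: aeW.
move=> a f g /ae_nullP f0 /ae_nullP g0; apply/ae_nullP.
apply: filterS2 f0 g0 => t ft gt.
by rewrite /= -[LHS]/(a *: f t + g t) ft gt scaler0 addr0.
Qed.

HB.instance Definition _ :=
  GRing.isSubmodClosed.Build R bochner_fun ae_null ae_null_submod_closed.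

(* Bochner integrable functions modulo almost everywhere equality *)
Definition L1 : Type := {ideal_quot ae_null}.
HB.instance Definition _ := GRing.Zmodule.on L1.
HB.instance Definition _ := EqQuotient.on L1.


Definition L1_class (f : bochner_fun) : L1 := \pi_L1 f.

Lemma L1_eqP (f g : bochner_fun) :
  L1_class f = L1_class g <-> {ae mu, forall t, f t = g t}.
Proof.
rewrite /L1_class; split => [/eqP|fg].
  rewrite -Quotient.idealrBE => /ae_nullP; apply: filterS => t.
  by move/eqP; rewrite subr_eq0 => /eqP.
apply/eqP; rewrite -Quotient.idealrBE; apply/ae_nullP.
by apply: filterS fg => t ft; rewrite -[LHS]/(f t - g t) ft subrr.
Qed.

Lemma L1_reprK x : L1_class (repr x) = x.
Proof. exact: reprK. Qed.

Lemma L1_repr (f : bochner_fun) : {ae mu, forall t, repr (L1_class f) t = f t}.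
Proof. by apply/L1_eqP; rewrite /L1_class reprK. Qed.

Definition L1_scale (a : R) (x : L1) : L1 := L1_class (a *: repr x).

Lemma L1_scaleE a f : L1_scale a (L1_class f) = L1_class (a *: f).
Proof.
apply/L1_eqP; apply: filterS (L1_repr f) => t ft.
by rewrite -[LHS]/(a *: (repr (L1_class f) t)) ft.
Qed.

Lemma L1_classD f g : L1_class (f + g) = L1_class f + L1_class g.
Proof. by rewrite /L1_class !piE. Qed.

Lemma L1_scaleA a b x : L1_scale a (L1_scale b x) = L1_scale (a * b) x.
Proof. by rewrite -[x]L1_reprK !L1_scaleE scalerA. Qed.

Lemma L1_scale1 : left_id 1 L1_scale.
Proof. by move=> x; rewrite -[x]L1_reprK L1_scaleE scale1r. Qed.

Lemma L1_scaleDr : right_distributive L1_scale +%R.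
Proof.
move=> a x y; rewrite -[x]L1_reprK -[y]L1_reprK.
by rewrite -L1_classD !L1_scaleE -L1_classD scalerDr.
Qed.

Lemma L1_scaleDl x : {morph L1_scale^~ x : a b / a + b}.
Proof.
by move=> a b; rewrite -[x]L1_reprK !L1_scaleE -L1_classD scalerDl.
Qed.

HB.instance Definition _ := GRing.Zmodule_isLmodule.Build R L1
  L1_scaleA L1_scale1 L1_scaleDr L1_scaleDl.

Definition L1_norm (x : L1) : R := fine (int_norm (repr x)).

Lemma bochner_fun_sm (f : bochner_fun) : strongly_measurable f.
Proof. by have /bochnerP[] := bochner_funP f. Qed.

Lemma int_norm_fin (f : bochner_fun) : int_norm f \is a fin_num.
Proof. by rewrite ge0_fin_numE ?int_norm_ge0//; have /bochnerP[] := bochner_funP f. Qed.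

Lemma L1_normE (f : bochner_fun) : L1_norm (L1_class f) = fine (int_norm f).
Proof.
congr fine; apply/eqP; rewrite eq_le; apply/andP; split; apply: le_int_norm;
  by apply: filterS (L1_repr f) => t ->.
Qed.

Lemma L1_normD x y : L1_norm (x + y) <= L1_norm x + L1_norm y.
Proof.
rewrite -[x]L1_reprK -[y]L1_reprK.
rewrite -L1_classD !L1_normE.
rewrite -lee_fin EFinD !fineK ?int_norm_fin//.
exact: int_normD (bochner_fun_sm _) (bochner_fun_sm _).
Qed.

Lemma L1_normZ a x : L1_norm (a *: x) = `|a| * L1_norm x.
Proof.
rewrite -[x]L1_reprK.
rewrite -[a *: _]/(L1_scale a _) L1_scaleE !L1_normE.
rewrite [X in fine X](int_normZ a (bochner_fun_sm (repr x))).
by rewrite fineM ?int_norm_fin.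
Qed.

Lemma L1_norm_eq0 x : L1_norm x = 0 -> x = 0.
Proof.
move=> x0; have : int_norm (repr x) = 0%E.
  by rewrite -[LHS]fineK ?int_norm_fin// -[fine _]/(L1_norm x) x0.
move/(int_norm_eq0 (bochner_fun_sm _)) => r0.
rewrite -[x]L1_reprK (_ : 0 = L1_class 0); last by rewrite /L1_class !piE.
by apply/L1_eqP.
Qed.

HB.instance Definition _ := Lmodule_isNormed.Build R L1
  L1_normD L1_normZ L1_norm_eq0.

End bochner.

Arguments bochner {d T R} mu X.

Section translation.
Context {R : realType}.
Notation mu := (@lebesgue_measure R).

Definition translation (t : R) : measurableTypeR R -> measurableTypeR R :=
  fun s => s - t.

Lemma measurable_translation t : measurable_fun setT (translation t).
Proof. exact: measurable_funB. Qed.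

HB.instance Definition _ t :=
  isMeasurableFun.Build _ _ _ _ (translation t) (measurable_translation t).

Lemma lebesgue_measure_translation t (A : set (measurableTypeR R)) :
  measurable A -> pushforward mu (translation t) A = mu A.
Proof.
move=> mA; apply/esym/lebesgue_measure_unique => //= _ [[a b]] _ <-.
rewrite /pushforward (_ : _ @^-1` _ = `]a + t, b + t]%classic).
  rewrite !lebesgue_measure_itv/= !lte_fin ltrD2r.
  by case: ifP => // _; rewrite -!EFinB opprD addrACA subrr addr0.
by apply/seteqP; split=> s; rewrite /translation /= !in_itv/=
  ltrBrDr lerBlDr.
Qed.

Lemma lebesgue_null_translation t (N : set (measurableTypeR R)) :
  measurable N -> mu N = 0%E -> mu (translation t @^-1` N) = 0%E.
Proof.
move=> mN N0.
by rewrite -[LHS]/(pushforward _ _ _) lebesgue_measure_translation.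
Qed.

Definition ae_translation t (P : measurableTypeR R -> Prop) := ae_preimage
  (P := P) (measurable_translation t) (@lebesgue_null_translation t).

Variable X : normedModType R.

Lemma int_norm_translation t (f : R -> X) : strongly_measurable mu f ->
  int_norm mu (f \o translation t) = int_norm mu f.
Proof.
move=> /strongly_measurable_norm[u [mu_ u0 fu ->]].
have /measurable_EFinP eu := mu_.
transitivity (\int[pushforward mu (translation t)]_s (u s)%:E)%E; last first.
  by apply: eq_measure_integral => // A mA _; exact: lebesgue_measure_translation.
rewrite ge0_integral_pushforward//; last by move=> s _; rewrite lee_fin.
have fut := ae_translation t fu.
by apply/eqP; rewrite eq_le; apply/andP; split;
  apply: ge0_ae_le_integral_sup => [s|s|]; rewrite ?lee_fin//=;
  apply: filterS fut => s; rewrite /translation /= => ->.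
Qed.

Lemma strongly_measurable_translation t (f : R -> X) :
  strongly_measurable mu f -> strongly_measurable mu (f \o translation t).
Proof.
move=> [f_ sf cf]; exists (fun n => f_ n \o translation t); last first.
  exact: ae_translation cf.
move=> n; have [fin mf] := sf n; split.
  by apply: sub_finite_set fin => _ [s _ <-]; exists (translation t s).
move=> x; rewrite comp_preimage -[X in measurable X]setTI.
exact: measurable_translation.
Qed.

Lemma bochner_shift (A : bounded_op X X) t (f : bochner_fun mu X) :
  (fun s : R => A (f (s - t))) \in bochner mu X.
Proof.
have /(strongly_measurable_translation t) sf := bochner_fun_sm f.
apply/bochnerP; split.
  have [f_ s_ cf] := sf; exists (fun n => A \o f_ n).
    by move=> n; exact: simple_function_comp.
  apply: filterS cf => s fs.
  by apply: continuous_cvg fs; exact: bounded_op_continuous.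
have [M M0 AM] := bounded_op_bound A.
apply: (@le_lt_trans _ _ (int_norm mu (M *: (f \o translation t)))).
  apply: le_int_norm; apply: aeW => s.
  by rewrite -[(M *: _) s]/(M *: f (s - t)) normrZ ger0_norm.
rewrite int_normZ// int_norm_translation; last exact: bochner_fun_sm.
by rewrite lte_mul_pinfty// -ge0_fin_numE ?int_norm_ge0// int_norm_fin.
Qed.

Definition bochner_shift_fun (A : bounded_op X X) t (f : bochner_fun mu X) :
  bochner_fun mu X := BochnerFun (bochner_shift A t f).

End translation.

Section semigroups.
Context {R : realType}.
Notation mu := (@lebesgue_measure R).

(* families are indexed by R; only the indices t >= 0 are constrained *)
Definition C0_semigroup (X : normedModType R) (S : R -> bounded_op X X) :=
  [/\ forall x, S 0 x = x,
      forall s t, 0 <= s -> 0 <= t -> forall x, S (s + t) x = S s (S t x) &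
      forall x, S t x @[t --> 0^'+] --> x].

Definition bounded_semigroup (X : normedModType R) (S : R -> bounded_op X X) :=
  exists M : R, forall t, 0 <= t -> opnorm (S t) <= M.

(* (T(t) f)(s) = S(t) f(s - t), computed on a representative of f; see
   shift_semigroupE for the independence of the representative *)
Definition shift_semigroup (X : normedModType R) (S : R -> bounded_op X X)
    (t : R) (f : L1 mu X) : L1 mu X :=
  L1_class (bochner_shift_fun (S t) t (repr f)).

Lemma shift_semigroupE (X : normedModType R) (S : R -> bounded_op X X) t
    (f : bochner_fun mu X) :
  shift_semigroup S t (L1_class f) = L1_class (bochner_shift_fun (S t) t f).
Proof.
apply/L1_eqP; have := L1_repr f; move=> /(ae_translation t).
by apply: filterS => s /= ->.
Qed.

Definition Eberlein_weakly_almost_periodic (V : normedModType R)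
    (T : R -> V -> V) :=
  forall f, relatively_weakly_compact [set T t f | t in [set t | 0 <= t]].

Definition strongly_stable (V : normedModType R) (T : R -> V -> V) :=
  forall f, T t f @[t --> +oo] --> (0 : V).

End semigroups.

(* Main.v *)
Require Import Defs.
From HB Require Import structures.
From mathcomp Require Import all_boot all_order all_algebra generic_quotient.
From mathcomp Require Import all_classical all_reals all_analysis.
From mathcomp Require Import measurable_realfun lra.

(** Write [T t] for the shift semigroup on [L^1(R, X)]. Translation invariance
    makes the norm of [T t f] the integral of [`|S t (f s)|] over [s], so by
    dominated convergence ([strongly_stable_shift]) it suffices that [S t x]
    tends to [0] for each [x] in [X]. As [S] is a bounded semigroup, this holds
    as soon as [`|S n x|] gets arbitrarily small along the integers [n]
    ([semigroup_cvg0]).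

    Suppose instead that [`|S n x| >= e > 0] for all [n], and let [f] be the
    function equal to [x] for [0 <= s < 1] and to [0] elsewhere. The functions
    [g n = T n f] live on the disjoint intervals [n <= s < n + 1] and have norm
    [`|S n x|]. Disjointness gives that the norm of [sum c_n g_n] is
    [sum `|c_n| `|g_n|] ([L1_norm_sum_disjoint]), so the Hahn-Banach theorem
    provides one continuous functional [phi] with [phi (g n) = `|g n| >= e] for
    all [n] ([dual_moment]). If the orbit of [f] were relatively weakly compact,
    the sequence [g] would have a weak cluster point [v]. Let [P m] be the
    restriction to the half-line [s >= m]. Since [P m] fixes [g n] for
    [n >= m], testing against [phi \o P m] gives [phi (P m v) >= e] for every
    [m]; but the tails [P m v] of the integrable function [v] tend to [0]
    ([relatively_weakly_compact_tails], [L1_restrict_cvg0]), a contradiction. *)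

Set Implicit Arguments.
Unset Strict Implicit.
Unset Printing Implicit Defensive.

Import Order.TTheory GRing.Theory Num.Theory.
Import numFieldNormedType.Exports.

Local Open Scope classical_set_scope.
Local Open Scope ring_scope.

(** * The Hahn-Banach theorem *)

Section hahn_banach.
Context {R : realType} (V : lmodType R) (p : V -> R).
Hypothesis p_subadd : forall u v, p (u + v) <= p u + p v.
Hypothesis p_pos_hom : forall a v, 0 <= a -> p (a *: v) = a * p v.

(** A partial linear functional below [p] is encoded by its graph. Domination by
    [p] already makes the graph single-valued, and both clauses hold of the
    empty set and pass to unions of chains, which is what Zorn's lemma asks. *)
Definition dominated_linear_graph (G : set (V * R)) :=
  (forall a u v r s, G (u, r) -> G (v, s) -> G (a *: u + v, a * r + s)) /\
  (forall u r, G (u, r) -> r <= p u).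

(* [G] may be empty, so closure under scaling is obtained from
   [a u = (a - 1) u + u] instead of from [a u + 0]. *)
Let graph_scale G a u r : dominated_linear_graph G ->
  G (u, r) -> G (a *: u, a * r).
Proof.
move=> [Glin _] Gur.
have := Glin (a - 1) _ _ _ _ Gur Gur.
by rewrite -{2}[u]scale1r -{2}[r]mul1r -scalerDl -mulrDl subrK.
Qed.

(** Two values at [u] differ by a value at [0], which is at most [p 0 = 0]. *)
Lemma dominated_linear_graph_fun G u r s : dominated_linear_graph G ->
  G (u, r) -> G (u, s) -> r = s.
Proof.
move=> GG Gr Gs; have [Glin Gp] := GG.
have p0 : p 0 = 0 by rewrite -(scale0r (0 : V)) p_pos_hom// mul0r.
suff le a b : G (u, a) -> G (u, b) -> b <= a.
  by apply/eqP; rewrite eq_le !le.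
move=> Ga Gb; have := Gp _ _ (Glin (-1) _ _ _ _ Ga Gb).
by rewrite scaleN1r addNr p0 mulN1r addrC subr_le0.
Qed.

(** The value [c] at the new vector [v] must satisfy [r - p (u - v) <= c] and
    [c <= p (u + v) - r] for all [(u, r)] in [G]; subadditivity of [p] puts
    every such lower bound below every such upper bound, so their supremum
    works. *)
Lemma dominated_linear_graph_extend G v : dominated_linear_graph G ->
  G (0, 0) ->
  exists G', [/\ dominated_linear_graph G', G `<=` G' & exists c, G' (v, c)].
Proof.
move=> GG G0; have [Glin Gp] := GG.
pose L := [set x.2 - p (x.1 - v) | x in G].
have Lub u r : G (u, r) -> ubound L (p (u + v) - r).
  move=> Gur _ [[w s] Gws <-] /=.
  have := Glin 1 _ _ _ _ Gws Gur; rewrite scale1r mul1r => /Gp.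
  have := p_subadd (w - v) (u + v); rewrite addrACA addNr addr0; lra.
have Lsup : has_sup L.
  split; first by exists (0 - p (0 - v)), (0, 0).
  by exists (p (0 + v) - 0); exact: Lub.
pose c := sup L.
have cle u r : G (u, r) -> r + c <= p (u + v).
  move=> Gur; rewrite addrC -lerBrDr; apply: ge_sup; first by case: Lsup.
  exact: Lub.
have lec u r : G (u, r) -> r - c <= p (u - v).
  move=> Gur; rewrite lerBlDr -lerBlDl.
  by apply: sup_upper_bound => //; exists (u, r).
exists [set x | exists a u r, G (u, r) /\ x = (u + a *: v, r + a * c)].
split; last 1 first.
- by exists c, 1, 0, 0; rewrite scale1r mul1r !add0r.
- split.
    move=> a _ _ _ _ [b [u [r [Gur [-> ->]]]]] [b' [w [s [Gws [-> ->]]]]].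
    exists (a * b + b'), (a *: u + w), (a * r + s); split; first exact: Glin.
    rewrite scalerDl scalerDr addrACA scalerA; congr (_, _).
    by rewrite mulrDl mulrDr addrACA mulrA.
  move=> _ _ [a [u [r [Gur [-> ->]]]]].
  (* Scaling by [`|a|] reduces to [a = 1] and [a = -1], that is to the upper
     and the lower bounds on [c]. *)
  have [a0|a0|->] := ltrgt0P a.
  + have := cle _ _ (graph_scale a^-1 GG Gur).
    rewrite -(ler_pM2l a0) -(p_pos_hom _ (ltW a0)) scalerDr scalerA mulrDr.
    by rewrite mulrA divff ?gt_eqF// scale1r mul1r.
  + have na0 : 0 < - a by rewrite oppr_gt0.
    have := lec _ _ (graph_scale (- a)^-1 GG Gur).
    rewrite -(ler_pM2l na0) -(p_pos_hom _ (ltW na0)) scalerBr scalerA mulrBr.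
    by rewrite mulrA divff ?gt_eqF// scale1r mul1r scaleNr mulNr !opprK.
  + by rewrite scale0r mul0r !addr0; exact: Gp.
by move=> [u r] Gur; exists 0, u, r; rewrite scale0r mul0r !addr0.
Qed.

(** A maximal dominated graph that contains [G] is total by the one-step
    extension. *)
Lemma hahn_banach (G : set (V * R)) : dominated_linear_graph G -> G (0, 0) ->
  exists phi : {linear V -> R^o},
    (forall v, phi v <= p v) /\ forall v r, G (v, r) -> phi v = r.
Proof.
move=> GG G0.
(* The empty chain has union [set0], hence the guard on [G `<=` A]. *)
have [F FP|A [[AA GA] Amax]] := @Zorn_bigcup _
  [set A | dominated_linear_graph A /\ (A !=set0 -> G `<=` A)].
  move=> Ftot; split; first split.
  - move=> a u v r s [A FA Aur] [B FB Bvs].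
    have [AB|BA] := Ftot _ _ FA FB.
      by exists B => //; apply: (FP _ FB).1.1 => //; exact: AB.
    by exists A => //; apply: (FP _ FA).1.1 => //; exact: BA.
  - by move=> u r [A FA]; exact: (FP _ FA).1.2.
  - move=> [x [A FA Ax]]; apply: subset_trans (bigcup_sup FA).
    by apply: (FP _ FA).2; exists x.
have A0 : A (0, 0).
  apply: contrapT => nA0.
  have AG : A = set0.
    by apply/eqP; apply: contrapT => /negP/set0P/GA/(_ _ G0).
  have AltG : A `<` G by rewrite AG; split=> [x []//|/(_ _ G0)[]].
  exact: (Amax _ AltG (conj GG (fun=> @subset_refl _ G))).
have {}GA : G `<=` A by apply: GA; exists (0, 0).
have Atot v : exists r, A (v, r).
  have [B [BB AB [c Bc]]] := dominated_linear_graph_extend v AA A0.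
  apply: contrapT => nA.
  have AltB : A `<` B by split=> // BA; apply: nA; exists c; exact: BA.
  exact: (Amax _ AltB (conj BB (fun=> subset_trans GA AB))).
have [f Af] := choice Atot.
have fE v r : A (v, r) -> f v = r by exact: dominated_linear_graph_fun (Af v).
have f_lin : linear (f : V -> R^o).
  by move=> a u v; apply: fE; apply: AA.1.
pose phi : {linear V -> R^o} :=
  HB.pack (f : V -> R^o) (GRing.isLinear.Build R V R^o *:%R f f_lin).
by exists phi; split=> [v|v r /GA/fE//]; exact: AA.2 (Af v).
Qed.
End hahn_banach.

(** * Functionals and weakly compact sets in a normed space *)

Section dual.
Context {R : realType} (V : normedModType R).

Lemma norm_le_continuous (W : normedModType R) (f : {linear V -> W}) (M : R) :
  (forall v, `|f v| <= M * `|v|) -> continuous f.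
Proof.
move=> fM; apply: bounded_linear_continuous; apply/linear_boundedP.
exists M; split; first exact: num_real.
by move=> N MN v; apply: le_trans (fM v) _; rewrite ler_wpM2r// ltW.
Qed.

(** Hahn-Banach applied to the graph of [sum c_m g_m |-> sum c_m r_m] on the
    span of [g]; the hypothesis is both the domination of that functional by
    the norm and the reason why it is well defined. *)
Lemma dual_moment (g : nat -> V) (r : nat -> R) :
  (forall (c : nat -> R) n,
     \sum_(m < n) c m * r m <= `|\sum_(m < n) c m *: g m|) ->
  exists phi : dual V, forall m, phi (g m) = r m.
Proof.
move=> rg.
(* Finite combinations are given by a sequence [c] for which the partial sums
   are eventually constant, so that two of them need no common length. *)
pose G := [set x : V * R | exists c : nat -> R, \forall n \near \oo,
  x = (\sum_(m < n) c m *: g m, \sum_(m < n) c m * r m)].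
have GG : dominated_linear_graph (fun v => `|v|) G.
  split.
    move=> a u v s t [c cu] [d dv]; exists (fun m => a * c m + d m).
    apply: filterS2 cu dv => n [-> ->] [-> ->].
    rewrite scaler_sumr mulr_sumr -!big_split /=.
    by congr (_, _); apply: eq_bigr => i _;
      rewrite ?(scalerDl, mulrDl) ?scalerA ?mulrA.
  by move=> u s [c /filter_ex[n [-> ->]]]; exact: rg.
have G0 : G (0, 0).
  exists (fun=> 0); apply: nearW => n.
  by congr (_, _); rewrite big1// => i _; rewrite ?scale0r ?mul0r.
have norm_hom a (v : V) : 0 <= a -> `|a *: v| = a * `|v|.
  by move=> a0; rewrite normrZ ger0_norm.
have [phi [phip phiG]] := hahn_banach (@ler_normD _ _) norm_hom GG G0.
have phi_cont : continuous phi.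
  apply: (@norm_le_continuous _ _ 1) => v; rewrite mul1r ler_norml phip andbT.
  by rewrite lerNl -linearN -normrN phip.
exists (BoundedOp phi_cont) => m; apply: phiG.
exists (fun i => (i == m)%:R); near=> n.
have mn : (m < n)%N by near: n; exact: nbhs_infty_gt.
have delta (i : 'I_n) : i != Ordinal mn -> (i == m :> nat) = false.
  by move=> im; exact/negbTE.
congr (_, _); rewrite (bigD1 (Ordinal mn))//= eqxx ?scale1r ?mul1r.
  by rewrite big1 ?addr0// => i /delta ->; rewrite scale0r.
by rewrite big1 ?addr0// => i /delta ->; rewrite mul0r.
Unshelve. all: by end_near. Qed.

Lemma bounded_op_comp_continuous (U W : normedModType R)
    (f : bounded_op V W) (g : bounded_op U V) :
  continuous (f \o g : {linear U -> W}).
Proof.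
by move=> x; apply: continuous_comp; exact: bounded_op_continuous.
Qed.

Definition bounded_op_comp (U W : normedModType R) (f : bounded_op V W)
    (g : bounded_op U V) : bounded_op U W :=
  BoundedOp (@bounded_op_comp_continuous U W f g).

(** Mass that escapes through the tails [P n] destroys weak compactness. A weak
    cluster point [v] of [g] satisfies [e <= phi (P m v)] for every [m], because
    [phi \o P m] is weakly continuous and takes the value [phi (g n)] at [g n]
    as soon as [m <= n]; and [P m v] tends to [0]. *)
Lemma relatively_weakly_compact_tails (A : set V) (P : nat -> bounded_op V V)
    (g : nat -> V) (phi : dual V) (e : R) :
  relatively_weakly_compact A -> (forall n, A (g n)) ->
  (forall v, P n v @[n --> \oo] --> (0 : V)) ->
  (forall m n, (m <= n)%N -> P m (g n) = g n) ->
  (forall n, e <= phi (g n)) -> e <= 0.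
Proof.
rewrite /relatively_weakly_compact precompactE => Acpt Ag P0 Pg ephi.
have gA : (g @ \oo) (closure (A : set (weak_space V))).
  by exists 0%N => // n _; exact: subset_closure.
have [v [_ gv]] := Acpt _ _ gA.
have eP m : e <= phi (P m v).
  rewrite leNgt; apply/negP => Pve.
  have vv : nbhs (v : weak_space V) --> (v : weak_space V) by [].
  have /(_ _ (bounded_op_comp phi (P m))) := (cvg_weak_space _ _).1 vv.
  move=> /cvgr_lt /(_ _ Pve) nv.
  have gm : (g @ \oo) (g @` [set n | (m <= n)%N]).
    by apply: filterS (nbhs_infty_ge m) => n mn; exists n.
  have [_ [[n /= mn <-]]] := gv _ _ gm nv.
  by rewrite Pg// ltNge ephi.
have /cvgr_to_ge : phi (P n v) @[n --> \oo] --> (0 : R).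
  rewrite -(linear0 phi); apply: continuous_cvg (P0 v).
  exact: bounded_op_continuous.
by apply; exact: nearW.
Qed.
End dual.

(** * Bochner integrable functions *)

Section bochner_lemmas.
Context d (T : measurableType d) (R : realType).
Variables (mu : {measure set T -> \bar R}) (X : normedModType R).
Implicit Types (f g : T -> X).

(** Dominated convergence. The norms of the functions are only almost everywhere
    equal to measurable functions, to which the scalar theorem applies. *)
Lemma int_norm_dominated (f_ : nat -> T -> X) g :
  (forall n, strongly_measurable mu (f_ n)) -> bochner_integrable mu g ->
  {ae mu, forall t n, `|f_ n t| <= `|g t|} ->
  {ae mu, forall t, f_ n t @[n --> \oo] --> 0} ->
  int_norm mu (f_ n) @[n --> \oo] --> 0%E.
Proof.
move=> sf [sg gfin] fg f0.
have [u uP] := choice (fun n => strongly_measurable_norm (sf n)).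
have [v [mv v0 gv gE]] := strongly_measurable_norm sg.
have fu : {ae mu, forall t n, `|f_ n t| = u n t}.
  by apply: ae_foralln => n; have [] := uP n.
have [|||||_ _] := @dominated_convergence _ _ _ mu setT measurableT
    (fun n t => (u n t)%:E) (cst 0%E) (fun t => (v t)%:E).
- by move=> n; apply/measurable_EFinP; have [] := uP n.
- exact: measurable_cst.
- apply: filterS2 fu f0 => t ftu ft0 _.
  apply/cvg_EFin; first exact: nearW.
  rewrite [X in X @ _](_ : _ = fun n => `|f_ n t|); last first.
    by apply/funext => n; rewrite ftu.
  by rewrite -[0](@normr0 _ X); exact: cvg_norm.
- apply/integrableP; split; first exact/measurable_EFinP.
  under eq_integral do rewrite gee0_abs ?lee_fin//.
  by rewrite -gE.
- apply: filterS3 fu fg gv => t ftu ftg gtv n _.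
  by rewrite gee0_abs ?lee_fin// -?ftu -?gtv//; have [] := uP n.
rewrite integral0 (_ : (fun n => int_norm mu (f_ n)) =
  (fun n => \int[mu]_t (u n t)%:E)%E)//.
by apply/funext => n; have [] := uP n.
Qed.

Lemma int_normD_disjoint f g :
  strongly_measurable mu f -> strongly_measurable mu g ->
  (forall t, f t = 0 \/ g t = 0) ->
  int_norm mu (f + g) = (int_norm mu f + int_norm mu g)%E.
Proof.
move=> sf sg fg.
have [u [mu_ u0 fu fE]] := strongly_measurable_norm sf.
have [v [mv v0 gv gE]] := strongly_measurable_norm sg.
rewrite fE gE -ge0_integralD//; do ?[exact/measurable_EFinP|
  by move=> t _; rewrite lee_fin].
by apply/eqP; rewrite eq_le; apply/andP; split;
  apply: ge0_ae_le_integral_sup => [t|t|]; rewrite ?adde_ge0 ?lee_fin//;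
  apply: filterS2 fu gv => t <- <-; rewrite -EFinD lee_fin;
  rewrite -[(f + g) t]/(f t + g t);
  have [->|->] := fg t; rewrite ?normr0 ?add0r ?addr0.
Qed.

Lemma L1_normrE (f : bochner_fun mu X) : `|L1_class f|%:E = int_norm mu f.
Proof. by rewrite -[`|_|]/(L1_norm _) L1_normE fineK ?int_norm_fin. Qed.

Lemma L1_classZ a (f : bochner_fun mu X) :
  L1_class (a *: f) = a *: L1_class f.
Proof. by rewrite -[RHS]/(L1_scale _ _) L1_scaleE. Qed.

Lemma bochner_funZE a (f : bochner_fun mu X) t : (a *: f) t = a *: f t.
Proof. by []. Qed.

Lemma bochner_funDE (f g : bochner_fun mu X) t : (f + g) t = f t + g t.
Proof. by []. Qed.

(** The induction carries a representative [F] of the sum that vanishes where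
    all the summands do, so that the next summand is disjoint from it. *)
Lemma L1_norm_sum_disjoint (f : nat -> bochner_fun mu X) n :
  (forall t i j, i != j -> f i t = 0 \/ f j t = 0) ->
  `|\sum_(i < n) L1_class (f i)| = \sum_(i < n) `|L1_class (f i)|.
Proof.
move=> f0.
suff [F [FE F0 <-]] : exists F : bochner_fun mu X,
    [/\ L1_class F = \sum_(i < n) L1_class (f i),
        forall t, (forall i, (i < n)%N -> f i t = 0) -> F t = 0 &
        `|L1_class F| = \sum_(i < n) `|L1_class (f i)|].
  by rewrite FE.
elim: n => [|n [F [FE F0 Fnorm]]].
  exists 0; rewrite !big_ord0; split=> //.
    by rewrite /L1_class !piE.
  by rewrite (_ : L1_class _ = 0) ?normr0 // /L1_class !piE.
exists (F + f n); split.
- by rewrite L1_classD FE big_ord_recr.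
- move=> t ft; rewrite bochner_funDE F0 ?ft ?addr0// => i ni.
  by apply: ft; exact: ltnW.
rewrite big_ord_recr /= -Fnorm; apply: EFin_inj.
rewrite EFinD !L1_normrE; apply: int_normD_disjoint.
- exact: bochner_fun_sm.
- exact: bochner_fun_sm.
move=> t; have [fn0|fn0] := pselect (f n t = 0); first by right.
left; apply: F0 => i ni.
by have /(f0 t)[] : i != n by rewrite ltn_eqF.
Qed.

Lemma simple_function_indic (E : set T) : measurable E ->
  simple_function (\1_E : T -> R).
Proof.
move=> mE; split.
  apply: (@sub_finite_set _ _ [set 0; 1]).
    by move=> _ [t _ <-] /=; rewrite indicE; case: (_ \in _); [right|left].
  exact: finite_set2.
by move=> y; rewrite -[X in measurable X]setTI; exact: measurable_indic.
Qed.

Lemma strongly_measurable_indic (E : set T) (x : X) :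
  measurable E -> strongly_measurable mu (fun t => \1_E t *: x).
Proof.
move=> mE; exists (fun=> fun t => \1_E t *: x); last first.
  by apply: aeW => t; exact: cvg_cst.
move=> _; apply: (simple_function_comp (fun a : R => a *: x)).
exact: simple_function_indic.
Qed.

Lemma int_norm_indic (E : set T) (x : X) : measurable E ->
  int_norm mu (fun t => \1_E t *: x) = (`|x|%:E * mu E)%E.
Proof.
move=> mE; rewrite /int_norm.
under eq_integral => t _.
  rewrite normrZ [`|\1_E t|]ger0_norm ?indicE ?ler0n// -indicE mulrC EFinM.
  over.
rewrite ge0_integralZl//.
- by rewrite integral_indic// setIT.
- exact/measurable_EFinP/measurable_indic.
Qed.

Lemma bochner_restrict_subproof (E : set T) (f : bochner_fun mu X) :
  measurable E -> (fun t => \1_E t *: f t) \in bochner mu X.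
Proof.
move=> mE; have [f_ s_ cf] := bochner_fun_sm f.
apply/bochnerP; split.
  exists (fun n t => \1_E t *: f_ n t).
    move=> n.
    apply: (simple_function_comp2 (fun (a : R) (x : X) => a *: x)) => //.
    exact: simple_function_indic.
  by apply: filterS cf => t ft; exact: cvgZr.
have /bochnerP[_] := bochner_funP f; apply: le_lt_trans.
apply: le_int_norm; apply: aeW => t; rewrite normrZ indicE.
by case: (_ \in _); rewrite ?normr1 ?normr0 ?mul1r ?mul0r.
Qed.

Definition bochner_restrict E (mE : measurable E) (f : bochner_fun mu X) :
  bochner_fun mu X := BochnerFun (bochner_restrict_subproof f mE).

Definition L1_restrict E (mE : measurable E) (f : L1 mu X) : L1 mu X :=
  L1_class (bochner_restrict mE (repr f)).

Lemma L1_restrictE E (mE : measurable E) (f : bochner_fun mu X) :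
  L1_restrict mE (L1_class f) = L1_class (bochner_restrict mE f).
Proof.
by apply/L1_eqP; apply: filterS (L1_repr f) => t /= ->.
Qed.

Lemma L1_restrict_linear E (mE : measurable E) : linear (L1_restrict mE).
Proof.
move=> a x y; rewrite -[x]L1_reprK -[y]L1_reprK -L1_classZ -L1_classD.
rewrite !L1_restrictE -L1_classZ -L1_classD; apply/L1_eqP; apply: aeW => t.
change (\1_E t *: (a *: repr x t + repr y t) =
  a *: (\1_E t *: repr x t) + \1_E t *: repr y t).
by rewrite scalerDr !scalerA mulrC.
Qed.

Lemma L1_restrict_le E (mE : measurable E) x :
  `|L1_restrict mE x| <= `|x|.
Proof.
rewrite -[x]L1_reprK L1_restrictE -lee_fin !L1_normrE; apply: le_int_norm.
apply: aeW => t /=; rewrite normrZ indicE.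
by case: (_ \in _); rewrite ?normr1 ?normr0 ?mul1r ?mul0r.
Qed.

Lemma L1_restrict_bounded_op E (mE : measurable E) :
  exists P : bounded_op (L1 mu X) (L1 mu X), forall x, P x = L1_restrict mE x.
Proof.
pose L : {linear L1 mu X -> L1 mu X} := HB.pack (L1_restrict mE)
  (GRing.isLinear.Build R (L1 mu X) (L1 mu X) *:%R _ (L1_restrict_linear mE)).
have Lc : continuous L.
  apply: (norm_le_continuous (M := 1)) => x; rewrite mul1r.
  exact: L1_restrict_le.
by exists (BoundedOp Lc).
Qed.

Lemma L1_restrict_cvg0 (E : nat -> set T) (mE : forall n, measurable (E n)) x :
  (forall t, \forall n \near \oo, ~ E n t) ->
  L1_restrict (mE n) x @[n --> \oo] --> (0 : L1 mu X).
Proof.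
move=> E0; rewrite -[x]L1_reprK; set f := repr x.
have : int_norm mu (bochner_restrict (mE n) f) @[n --> \oo] --> 0%E.
  apply: (@int_norm_dominated _ f).
  - by move=> n; exact: bochner_fun_sm.
  - exact/bochnerP/bochner_funP.
  - apply: aeW => t n /=; rewrite normrZ indicE.
    by case: (_ \in _); rewrite ?normr1 ?normr0 ?mul1r ?mul0r.
  - apply: aeW => t; apply: cvg_near_cst.
    by apply: filterS (E0 t) => n Ent /=; rewrite indicE memNset// scale0r.
move=> /fine_cvg fE0; apply/norm_cvg0P; apply: cvg_trans fE0.
by under eq_fun do rewrite L1_restrictE -[`|_|]/(L1_norm _) L1_normE.
Qed.
End bochner_lemmas.

(** * Shifted functions and pulses on the line *)

Section shifts.
Context {R : realType} {X : normedModType R}.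
Notation mu := (@lebesgue_measure R).

Lemma strongly_measurable_op (A : bounded_op X X) (f : bochner_fun mu X) :
  strongly_measurable mu (A \o f).
Proof.
(* [A \o f] is the image of [f] under [A] and the translation by [0]. *)
have := bochner_fun_sm (bochner_shift_fun A 0 f).
by rewrite /=; under [X in strongly_measurable _ X]eq_fun do rewrite subr0.
Qed.

Lemma int_norm_shift (A : bounded_op X X) t (f : bochner_fun mu X) :
  int_norm mu (bochner_shift_fun A t f) = int_norm mu (A \o f).
Proof. exact: int_norm_translation (strongly_measurable_op A f). Qed.

Lemma measurable_unit_itv :
  measurable (`[0, 1[%classic : set (measurableTypeR R)).
Proof. exact: measurable_itv. Qed.

Lemma int_norm_pulse (x : X) :
  int_norm mu (fun s => \1_(`[0, 1[%classic : set R) s *: x) = `|x|%:E.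
Proof.
have mu1 : mu (`[0, 1[%classic : set R) = 1%E.
  by rewrite lebesgue_measure_itv/= lte_fin ltr01 oppr0 adde0.
rewrite (int_norm_indic mu x measurable_unit_itv).
by rewrite [X in (_ * X)%E]mu1 mule1.
Qed.

Lemma pulse_subproof (x : X) :
  (fun s => \1_(`[0, 1[%classic : set R) s *: x) \in bochner mu X.
Proof.
apply/bochnerP; split; last by rewrite int_norm_pulse ltry.
exact: strongly_measurable_indic measurable_unit_itv.
Qed.

(** Unit length makes the norm of [pulse x] equal to that of [x], and makes the
    shifts of [pulse x] by distinct integers disjoint. *)
Definition pulse (x : X) : bochner_fun mu X := BochnerFun (pulse_subproof x).

(** [A] maps [0] to [0], so it does not enlarge supports. *)
Lemma shift_pulse_supp (A : bounded_op X X) (x : X) (m : nat) s :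
  bochner_shift_fun A m%:R (pulse x) s != 0 -> m%:R <= s < m.+1%:R.
Proof.
rewrite /= indicE; case: (boolP (_ \in _)) => [|_]; last first.
  by rewrite scale0r linear0 eqxx.
by rewrite inE/= in_itv/= subr_ge0 ltrBlDl natr1 => ? _.
Qed.

Lemma shift_pulse_disjoint (A : nat -> bounded_op X X) (x : X) s i j :
  i != j -> bochner_shift_fun (A i) i%:R (pulse x) s = 0 \/
            bochner_shift_fun (A j) j%:R (pulse x) s = 0.
Proof.
move=> ij; apply: contrapT => /not_orP[/eqP/shift_pulse_supp/andP[i1 i2]].
move=> /eqP/shift_pulse_supp/andP[j1 j2].
have := le_lt_trans i1 j2; have := le_lt_trans j1 i2.
rewrite !ltr_nat !ltnS => ji ij'.
by move/negP: ij; apply; rewrite eqn_leq ij' ji.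
Qed.
End shifts.

(** * Stability of the semigroup and of its shifts *)

Section stability.
Context {R : realType} {X : normedModType R} (S : R -> bounded_op X X).
Notation mu := (@lebesgue_measure R).

(** If the norms of [S n x] stayed above [e], the shifted pulses
    [g n = T n (pulse x)], which are disjointly supported, would span an
    isometric copy of a weighted [l^1]. Some functional then takes the value
    [`|g n|] at every [g n], while the [g n] escape through the restrictions to
    the half-lines [s >= m]. *)
Lemma weakly_compact_pulse_orbit (x : X) (e : R) :
  relatively_weakly_compact
    [set shift_semigroup S t (L1_class (pulse x)) | t in [set t | 0 <= t]] ->
  0 < e -> exists n : nat, `|S n%:R x| < e.
Proof.
move=> cptx e0; apply: contrapT => Sxe.
have {}Sxe n : e <= `|S n%:R x|.
  by rewrite leNgt; apply/negP => ?; apply: Sxe; exists n.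
pose h n := bochner_shift_fun (S n%:R) n%:R (pulse x).
pose g n : L1 mu X := L1_class (h n).
have gE n : `|g n| = `|S n%:R x|.
  apply: EFin_inj; rewrite L1_normrE int_norm_shift -int_norm_pulse.
  by congr int_norm; apply/funext => s; rewrite /= linearZ.
have [phi phig] : exists phi : dual (L1 mu X), forall n, phi (g n) = `|g n|.
  apply: dual_moment => c n.
  under [X in `|X|]eq_bigr do rewrite -L1_classZ.
  rewrite (L1_norm_sum_disjoint (f := fun i => c i *: h i)).
    apply: ler_sum => i _; rewrite L1_classZ normrZ.
    by rewrite ler_wpM2r// ler_norm.
  move=> s i j ij; rewrite !bochner_funZE.
  by have [->|->] := shift_pulse_disjoint (fun i => S i%:R) x s ij;
    rewrite scaler0; [left|right].
pose E (m : nat) : set (measurableTypeR R) := `[m%:R, +oo[%classic.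
have mE m : measurable (E m) by exact: measurable_itv.
have [P PE] := choice (fun m => @L1_restrict_bounded_op _ _ _ mu X _ (mE m)).
suff : e <= 0 by rewrite leNgt e0.
apply: (relatively_weakly_compact_tails (P := P) (g := g) (phi := phi) cptx).
- move=> n; exists n%:R; first exact: ler0n.
  by rewrite shift_semigroupE.
- move=> v; under eq_fun do rewrite PE.
  apply: L1_restrict_cvg0 => t.
  apply: filterS (nbhs_infty_gtr t) => n tn; rewrite /E /= in_itv/= andbT.
  by apply/negP; rewrite -ltNge.
- move=> m n mn; rewrite PE L1_restrictE; apply/L1_eqP; apply: aeW => s.
  change (\1_(E m) s *: h n s = h n s).
  have [->|/shift_pulse_supp/andP[ns _]] := eqVneq (h n s) 0.
    by rewrite scaler0.
  rewrite indicE mem_set ?scale1r// /E /= in_itv/= andbT.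
  by rewrite (le_trans _ ns)// ler_nat.
- by move=> n; rewrite phig gE.
Qed.

Hypothesis semigroupS : C0_semigroup S.
Variable M : R.
Hypothesis M0 : 0 < M.
Hypothesis SM : forall t x, 0 <= t -> `|S t x| <= M * `|x|.

(** Along an orbit of a bounded semigroup the norm never grows by more than the
    factor [M], so that smallness at one time persists, and control along the
    integers is enough. *)
Lemma semigroup_norm_le s t x : 0 <= s -> s <= t -> `|S t x| <= M * `|S s x|.
Proof.
have [_ Sadd _] := semigroupS.
move=> s0 st; rewrite -{1}(subrK s t) Sadd ?subr_ge0//.
by apply: SM; rewrite subr_ge0.
Qed.

Lemma semigroup_cvg0 x : (forall e, 0 < e -> exists n : nat, `|S n%:R x| < e) ->
  S n%:R x @[n --> \oo] --> (0 : X).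
Proof.
move=> Sx; apply/cvgr0Pnorm_lt => e e0.
have [n Snx] := Sx (e / M) (divr_gt0 e0 M0).
apply: filterS (nbhs_infty_ge n) => m nm.
apply: (@le_lt_trans _ _ (M * `|S n%:R x|)).
  by apply: semigroup_norm_le; rewrite ?ler_nat.
by rewrite mulrC -ltr_pdivlMr.
Qed.

(** The norm of [T t f] is the integral of [`|S t (f s)|] by translation
    invariance; the integrands tend to [0] pointwise and are dominated by
    [M `|f s|]. *)
Lemma strongly_stable_shift :
  (forall x, S n%:R x @[n --> \oo] --> (0 : X)) ->
  strongly_stable (shift_semigroup S).
Proof.
move=> S0 f; rewrite -[f]L1_reprK; set f0 := repr f.
have norm_shift t : `|shift_semigroup S t (L1_class f0)|%:E =
    int_norm mu (S t \o f0).
  by rewrite shift_semigroupE L1_normrE int_norm_shift.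
have Sf0 : int_norm mu (S n%:R \o f0) @[n --> \oo] --> 0%E.
  apply: (@int_norm_dominated _ _ _ _ _ _ (M *: f0)).
  - by move=> n; exact: strongly_measurable_op.
  - exact/bochnerP/bochner_funP.
  - apply: aeW => s n; rewrite bochner_funZE normrZ gtr0_norm//.
    exact: SM.
  - by apply: aeW => s; exact: S0.
have {}Sf0 : shift_semigroup S n%:R (L1_class f0) @[n --> \oo] -->
    (0 : L1 mu X).
  apply/norm_cvg0P; move/fine_cvg: Sf0; apply: cvg_trans.
  by under eq_fun do rewrite -[`|_|]/(fine `|_|%:E) norm_shift.
apply/cvgr0Pnorm_lt => e e0.
have [n _ /(_ n (leqnn n)) Snf] := (cvgr0Pnorm_lt _).1 Sf0 _ (divr_gt0 e0 M0).
apply: filterS (nbhs_pinfty_ge (num_real (n%:R : R))) => t nt.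
apply: (@le_lt_trans _ _ (M * `|shift_semigroup S n%:R (L1_class f0)|));
  last first.
  by rewrite mulrC -ltr_pdivlMr.
rewrite -lee_fin EFinM !norm_shift.
rewrite -[M]gtr0_norm// -int_normZ; last exact: strongly_measurable_op.
apply: le_int_norm; apply: aeW => s.
rewrite -[(M *: _) s]/(M *: (S n%:R (f0 s))) normrZ (gtr0_norm M0).
exact: semigroup_norm_le.
Qed.
End stability.

Theorem theorem3p5 (R : realType) (X : completeNormedModType R)
    (S : R -> bounded_op X X)
    (semigroupS : C0_semigroup S) (boundedS : bounded_semigroup S) :
  Eberlein_weakly_almost_periodic (shift_semigroup S) ->
  strongly_stable (shift_semigroup S).
Proof.
move=> wap; have [M SM] := boundedS.
(* The bound [M] may be [0], and the estimates divide by it. *)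
pose M' := Num.max M 1; have M'0 : 0 < M' by rewrite lt_max ltr01 orbT.
have SM' t x : 0 <= t -> `|S t x| <= M' * `|x|.
  move=> t0; apply: le_trans (le_opnorm _ _) _.
  by rewrite ler_wpM2r// le_max SM.
apply: (strongly_stable_shift semigroupS M'0 SM') => x.
apply: (semigroup_cvg0 semigroupS M'0 SM') => e.
exact: weakly_compact_pulse_orbit.
Qed.
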